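(* Let $r$ be a positive integer. If a Hadamard matrix of order $2r$ exists, then the $(2r-1)$-dimensional homology $H_{2r-1}(\mathcal{VR}(Q_n;r);\mathbb{Z})$ is non-trivial for all integers $n\ge 2r-1$.
   Context: $Q_n=\{\pm1\}^n$ is equipped with the Hamming distance $d$, where $d(x,y)$ is the number of coordinates in which $x$ and $y$ differ. For $r\ge 0$, the Vietoris--Rips complex $\mathcal{VR}(Q_n;r)$ is the simplicial complex with vertex set $Q_n$ whose simplices are the nonempty subsets $\sigma\subseteq Q_n$ with $d(x,y)\le r$ for all $x,y\in\sigma$. A Hadamard matrix of order $m$ is a matrix $H\in\{\pm1\}^{m\times m}$ satisfying $H^TH=HH^T=mI$.
   Formalization: The case r = 1, n = 1 is excluded: a Hadamard matrix of order 2 exists, but VR(Q_1;1) is a single edge, so its first homology vanishes and the claim fails there; all other r and n ≥ 2r−1 are covered. *)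

(* Defs.v *)
From HB Require Import structures.
From mathcomp Require Import all_boot all_order all_algebra.
From mathcomp Require Import boolp.

Set Implicit Arguments.
Unset Strict Implicit.
Unset Printing Implicit Defensive.

Import GRing.Theory.
Local Open Scope ring_scope.

(* Not every x : T need be a vertex of K: the vertices are the x with
   [set x] \in K. *)
Record simplicial_complex (T : finType) := SimplicialComplex {
  simplices :> {set {set T}};
  complex_set0 : set0 \notin simplices;
  complex_sub : forall s t : {set T},
    s \in simplices -> t \subset s -> t != set0 -> t \in simplices }.

Section Chains.

Variables (T : finType) (K : simplicial_complex T) (k : nat).

Definition ksimplex := {s : {set T} | (s \in K) && (#|s| == k.+1)}.
HB.instance Definition _ := Finite.on ksimplex.

Definition kchain := {ffun ksimplex -> int}.
HB.instance Definition _ := GRing.Zmodule.on kchain.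

End Chains.

(* Simplices are oriented by the enumeration order of T: the coefficient of t
   in the boundary of s = {v_0 < ... < v_k} is (-1)^i if t = s \ {v_i}, and 0
   if t is not of this form. *)
Definition incidence (T : finType) (s t : {set T}) : int :=
  \sum_(v in s | t == s :\ v)
    (-1) ^+ #|[set w in s | (enum_rank w < enum_rank v)%N]|.

(* A 0-simplex has no face among the 0-simplices, so the boundary of a 0-chain
   is 0, although 0.-1 = 0 makes its codomain the 0-chains. *)
Definition boundary (T : finType) (K : simplicial_complex T) (k : nat)
    (c : kchain K k) : kchain K k.-1 :=
  [ffun t => \sum_s incidence (val s) (val t) * c s].

Lemma boundary_is_zmod_morphism (T : finType) (K : simplicial_complex T)
    (k : nat) : zmod_morphism (@boundary T K k).
Proof.
move=> c d; apply/ffunP => t; rewrite !ffunE -sumrB.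
by apply: eq_bigr => s _; rewrite !ffunE mulrBr.
Qed.

HB.instance Definition _ T K k :=
  GRing.isZmodMorphism.Build _ _ (@boundary T K k)
    (@boundary_is_zmod_morphism T K k).

Section HomologyGroup.

Variables (T : finType) (K : simplicial_complex T) (k : nat).

Definition is_kcycle : {pred kchain K k} := fun c => boundary c == 0.

Lemma is_kcycle_zmod_closed : zmod_closed is_kcycle.
Proof.
split; first by rewrite unfold_in raddf0.
move=> c d; rewrite !unfold_in => /eqP cE /eqP dE.
by rewrite raddfB /= cE dE subr0.
Qed.

HB.instance Definition _ :=
  GRing.isZmodClosed.Build _ is_kcycle is_kcycle_zmod_closed.

Record kcycle := KCycle {
  kcycle_chain :> kchain K k;
  _ : kcycle_chain \in is_kcycle }.

HB.instance Definition _ := [isSub for kcycle_chain].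
HB.instance Definition _ := [Choice of kcycle by <:].
HB.instance Definition _ := [SubChoice_isSubZmodule of kcycle by <:].

(* Boundaries are cycles, so this predicate on cycles cuts out the whole image
   of the boundary map. *)
Definition is_kboundary : {pred kcycle} :=
  fun z => `[< exists b : kchain K k.+1, boundary b = z >].

Lemma is_kboundary_zmod_closed : zmod_closed is_kboundary.
Proof.
split; first by apply/asboolP; exists 0; rewrite raddf0.
move=> y z /asboolP[b bE] /asboolP[c cE]; apply/asboolP.
by exists (b - c); rewrite raddfB /= bE cE.
Qed.

HB.instance Definition _ :=
  GRing.isZmodClosed.Build _ is_kboundary is_kboundary_zmod_closed.

Definition homology : zmodType := Quotient.quot is_kboundary.

End HomologyGroup.

Definition sign := seq_sub [:: 1; -1 : int].
HB.instance Definition _ := Finite.on sign.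

Definition cube (n : nat) := {ffun 'I_n -> sign}.
HB.instance Definition _ n := Finite.on (cube n).

Definition hamming (n : nat) (x y : cube n) : nat := #|[set i | x i != y i]|.

Definition vr_simplices (n r : nat) : {set {set cube n}} :=
  [set s : {set cube n} | (s != set0) &&
    [forall x in s, forall y in s, (hamming x y <= r)%N]].

Lemma vr_set0 (n r : nat) : set0 \notin vr_simplices n r.
Proof. by rewrite inE eqxx. Qed.

Lemma vr_sub (n r : nat) (s t : {set cube n}) :
  s \in vr_simplices n r -> t \subset s -> t != set0 -> t \in vr_simplices n r.
Proof.
rewrite !inE => /andP[_ /forall_inP sr] /subsetP ts -> /=.
apply/forall_inP => x /ts xs; apply/forall_inP => y /ts ys.
by move/forall_inP: (sr x xs); apply.
Qed.

Definition vietoris_rips (n r : nat) : simplicial_complex (cube n) :=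
  SimplicialComplex (vr_set0 n r) (@vr_sub n r).

Definition hadamard (m : nat) (H : 'M[int]_m) : Prop :=
  [/\ forall i j, H i j = 1 \/ H i j = -1,
      H^T *m H = m%:R%:M & H *m H^T = m%:R%:M].

(* Main.v *)
Require Import Defs.
From HB Require Import structures.
From mathcomp Require Import all_boot all_order all_algebra.
From mathcomp Require Import boolp ring zify.

Set Implicit Arguments.
Unset Strict Implicit.
Unset Printing Implicit Defensive.

Import Order.TTheory GRing.Theory Num.Theory.
Local Open Scope ring_scope.

(** Scale the rows of a Hadamard matrix of order [m = 2r] so that its last
    column is constantly 1, and let [v_i^+], [v_i^-] be plus or minus the
    [i]-th row, cut or padded with ones to length [n].  Distinct rows are
    orthogonal, so they differ in exactly [r] places, and [v_i^b], [v_j^c] are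
    within distance [r] whenever [i <> j]: every choice of signs yields a
    simplex.  These [2^m] simplices are the facets of a cross-polytope
    boundary, a sphere of dimension [m - 1 = 2r - 1], and a suitable signed sum
    of them is a cycle ([crosspolytope_cycle]).

    The cycle does not bound because its facet [F] of all the [v_i^+] is
    maximal, once coordinates beyond the [m]-th are forgotten
    ([facet_maximal]).  Read a point of the cube as [u] in [{1,-1}^m]; if it is
    within [r] of all the rows [g_i], then the dot products [c_i = g_i . u] are
    nonnegative.  Orthogonality of the columns gives
    [sum_i c_i = m u_last <= m] and [sum_i c_i^2 = m |u|^2 = m^2], while
    [0 <= c_i <= m].  Hence every [c_i] is 0 or [m], some [c_i] is [m], and [u]
    is that row ([row_of_nonneg_dot]).

    Forgetting the extra coordinates is a map [p] of the vertices.  Count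
    modulo 2 the simplices of a chain that [p] sends onto [F].  A simplex with
    one vertex too many whose image is [F] has exactly two faces over [F], and
    by maximality no other simplex of that size has any; so the count vanishes
    on boundaries ([sum_boundary_over_fiber]).  On the cross-polytope cycle
    only [F] itself contributes, so the count is 1
    ([crosspolytope_homology]). *)

(** * A mod 2 invariant of homology classes *)

(** By pigeonhole, if [f] maps [s] onto [R] then exactly one pair [x], [y] in
    [s] is identified, and the faces over [R] are the ones missing [x] or [y].
    If the image of [s] is not [R], the second hypothesis leaves no face over
    [R]. *)
Lemma even_onto_faces (T U : finType) (f : T -> U) (s : {set T})
    (R : {set U}) :
  #|s| = #|R|.+1 -> (R \subset f @: s -> f @: s = R) ->
  ~~ odd #|[set v in s | f @: (s :\ v) == R]|.
Proof.
move=> sR Rmax.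
have [imR|/eqP imNR] := eqVneq (f @: s) R; last first.
  rewrite (_ : [set v in s | _] = set0) ?cards0 //.
  apply/setP => v; rewrite !inE; apply/negbTE/negP => /andP[_ /eqP imv].
  by apply/imNR/Rmax; rewrite -imv imsetS ?subsetDl.
have /dinjectivePn [x xs [y]] : ~~ dinjectiveb f (mem s).
  apply/negP => /dinjectiveP/card_in_imset; rewrite imR sR => /esym/eqP.
  by rewrite eqn_leq ltnn.
rewrite !inE => /andP[yx ys] fxy.
rewrite (_ : [set v in s | _] = [set x; y]) ?cards2 1?eq_sym ?yx //.
have drop a b : a \in s -> b \in s -> b != a -> f a = f b ->
    f @: (s :\ a) = R.
  move=> as_ bs ba fab; rewrite -imR; apply/eqP.
  rewrite eqEsubset imsetS ?subsetDl //=; apply/subsetP => _ /imsetP[c cs ->].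
  have [->|ca] := eqVneq c a; last by apply: imset_f; rewrite !inE ca.
  by rewrite fab; apply: imset_f; rewrite !inE ba.
apply/setP => v; rewrite !inE.
apply/andP/orP => [[vs /eqP imv]|[] /eqP->]; last first.
- by split=> //; apply/eqP/(drop y x) => //; rewrite eq_sym.
- by split=> //; apply/eqP/(drop x y).
apply/orP; apply: contra_eqT fxy; rewrite negb_or => /andP[vx vy].
have inj : {in s :\ v &, injective f}.
  apply/imset_injP; rewrite imv.
  by move: (cardsD1 v s); rewrite vs sR => -[->].
apply: contra_neq yx => fE.
by apply/esym/inj => //; rewrite !inE ?xs ?ys andbT eq_sym.
Qed.

Definition to_ksimplex (T : finType) (K : simplicial_complex T) (k : nat)
    (s : {set T}) (sP : (s \in K) && (#|s| == k.+1)) : ksimplex K k :=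
  exist (fun s : {set T} => (s \in K) && (#|s| == k.+1)) s sP.

Lemma intr_sign_F2 (n : nat) : (((-1) ^+ n)%:~R : 'F_2) = 1.
Proof.
rewrite rmorphXn rmorphN1 (_ : -1 = 1 :> 'F_2) ?expr1n //.
exact/val_inj.
Qed.

Lemma F2_natr (n : nat) : (n%:R : 'F_2) = (odd n)%:R.
Proof.
rewrite -[in LHS](odd_double_half n) natrD -mul2n natrM.
by rewrite (_ : 2%:R = 0 :> 'F_2) ?mul0r ?addr0 //; apply/val_inj.
Qed.

(** The sum over the [k]-simplices mapped onto [R] is a cocycle modulo 2, where
    all incidence numbers are 1: exchanging the sums, each [k.+1]-simplex
    contributes its number of faces over [R], which is even. *)
Lemma sum_boundary_over_fiber (T U : finType) (K : simplicial_complex T)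
    (f : T -> U) (k : nat) (R : {set U}) (b : kchain K k.+1) :
  #|R| = k.+1 ->
  (forall s : {set T}, s \in K -> R \subset f @: s -> f @: s = R) ->
  \sum_(t : ksimplex K k | f @: val t == R) (boundary b t)%:~R = 0 :> 'F_2.
Proof.
move=> Rk Rmax.
under eq_bigr do rewrite ffunE rmorph_sum.
rewrite exchange_big big1 //= => s _.
under eq_bigr do rewrite rmorphM.
rewrite -big_distrl /=.
have /andP[sK /eqP sk] := valP s.
suff -> : \sum_(t : ksimplex K k | f @: val t == R)
    (incidence (val s) (val t))%:~R = 0 :> 'F_2 by rewrite mul0r.
under eq_bigr => t _.
  rewrite /incidence rmorph_sum big_mkcondr /=.
  under eq_bigr => v _ do rewrite intr_sign_F2.
  over.
rewrite exchange_big /=.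
transitivity (\sum_(v in val s | f @: (val s :\ v) == R) (1 : 'F_2)).
  rewrite [RHS]big_mkcondr; apply: eq_bigr => v vs.
  have vP : (val s :\ v \in K) && (#|val s :\ v| == k.+1).
    have := cardsD1 v (val s); rewrite vs sk => /esym/eqP; rewrite eqSS => c.
    rewrite c andbT; apply: complex_sub sK (subsetDl _ _) _.
    by rewrite -card_gt0 (eqP c).
  pose t0 := to_ksimplex vP.
  rewrite -big_mkcondr /=.
  rewrite (eq_bigl (fun t => (t == t0) && (f @: (val s :\ v) == R))).
    by rewrite big_mkcondr big_pred1_eq.
  move=> t; rewrite [t == t0](_ : _ = (val t == val s :\ v)) //= andbC.
  by case: eqVneq => //= ->.
rewrite sumr_const F2_natr.
rewrite (_ : #|_| = #|[set v in val s | f @: (val s :\ v) == R]|); last first.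
  by apply: eq_card => v; rewrite !inE.
rewrite (negbTE (even_onto_faces _ _)) ?sk ?Rk //; exact: Rmax.
Qed.

(** * The fundamental cycle of a cross-polytope *)

Definition inversion (T : finType) (N : nat) (x : 'I_N -> T) (a b : 'I_N) :
    int :=
  (-1) ^+ (enum_rank (x b) < enum_rank (x a))%N.

Definition inversion_sign (T : finType) (N : nat) (x : 'I_N -> T) : int :=
  \prod_(a : 'I_N) \prod_(b : 'I_N | (a < b)%N) inversion x a b.

Lemma inversion_antisym (T : finType) (N : nat) (x : 'I_N -> T) (a b : 'I_N) :
  injective x -> a != b -> inversion x a b * inversion x b a = -1.
Proof.
move=> xI ab; rewrite /inversion; case: ltngtP => //= /val_inj/enum_rank_inj/xI.
by move/eqP; rewrite eq_sym (negbTE ab).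
Qed.

(** Up to a sign that depends only on the position [i], the incidence number of
    the face opposite [x i] turns the inversion sign of [x] into that of [x]
    without its [i]-th entry.  A later [b > i] contributes [inversion x i b]
    to both factors on the left, hence 1; an earlier [a < i] contributes
    [inversion x a i] and [inversion x i a], hence -1. *)
Lemma inversion_sign_delete (T : finType) (N : nat) (x : 'I_N -> T)
    (i : 'I_N) : injective x ->
  inversion_sign x *
    (-1) ^+ #|[set w in x @: setT | (enum_rank w < enum_rank (x i))%N]| =
  (-1) ^+ i *
    \prod_(a : 'I_N | a != i) \prod_(b : 'I_N | (a < b)%N && (b != i))
      inversion x a b.
Proof.
move=> xI.
have -> : (-1) ^+ #|[set w in x @: setT | (enum_rank w < enum_rank (x i))%N]| =
    \prod_j inversion x i j.
  rewrite (_ : [set w in _ | _] =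
    x @: [set j | (enum_rank (x j) < enum_rank (x i))%N]); last first.
    apply/setP => w; rewrite inE; apply/andP/imsetP => [[/imsetP[j _ ->] lt]|].
      by exists j; rewrite ?inE.
    by move=> [j]; rewrite inE => lt ->; rewrite imset_f.
  rewrite card_imset // -prodr_const big_mkcond /=; apply: eq_bigr => j _.
  by rewrite inE /inversion; case: ltnP.
have -> : \prod_j inversion x i j =
    (\prod_(j : 'I_N | (j < i)%N) inversion x i j) *
    \prod_(j : 'I_N | (i < j)%N) inversion x i j.
  rewrite (bigID (fun j : 'I_N => (j < i)%N)) /=; congr (_ * _).
  rewrite (bigD1 i) ?ltnn //= {1}/inversion ltnn mul1r.
  by apply: eq_bigl => j; rewrite -leqNgt ltn_neqAle eq_sym andbC.
rewrite /inversion_sign (bigD1 i) //=.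
have -> :
    \prod_(a : 'I_N | a != i) \prod_(b : 'I_N | (a < b)%N) inversion x a b =
    (\prod_(a : 'I_N | (a < i)%N) inversion x a i) *
    \prod_(a : 'I_N | a != i) \prod_(b : 'I_N | (a < b)%N && (b != i))
      inversion x a b.
  rewrite [X in X * _](_ : _ =
    \prod_(a : 'I_N | a != i) if (a < i)%N then inversion x a i else 1).
    rewrite -big_split; apply: eq_bigr => a _ /=.
    case: ifP => ai; first by rewrite (bigD1 i).
    rewrite mul1r; apply: eq_bigl => b.
    by case: eqVneq => [->|]; rewrite ?ai ?andbT.
  rewrite -big_mkcondr; apply: eq_bigl => a /=.
  by rewrite -val_eqE /=; case: ltngtP.
have sq : (\prod_(j : 'I_N | (i < j)%N) inversion x i j) *
          (\prod_(j : 'I_N | (i < j)%N) inversion x i j) = 1.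
  by rewrite -big_split big1 //= => j _; rewrite /inversion; case: ltnP.
have lt : (\prod_(a : 'I_N | (a < i)%N) inversion x a i) *
          (\prod_(j : 'I_N | (j < i)%N) inversion x i j) = (-1) ^+ i.
  rewrite -big_split /= (eq_bigr (fun=> -1)) => [|a ai]; last first.
    by rewrite inversion_antisym // -val_eqE neq_ltn ai.
  rewrite prodr_const; congr (_ ^+ _).
  by rewrite -sum1_card -(big_ord_widen N (fun=> 1%N)) ?sum1_card ?card_ord //
    ltnW.
rewrite -lt -[RHS]mul1r -[X in _ = X * _]sq; ring.
Qed.

Definition facet (T : finType) (N : nat) (v : 'I_N -> bool -> T)
    (e : {ffun 'I_N -> bool}) : {set T} :=
  [set v i (e i) | i in [set: 'I_N]].

(** The sign of the facet in the join of the 0-spheres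
    [v i true - v i false], oriented by the order of the index [i]; the second
    factor converts this to the orientation by the enumeration of [T]. *)
Definition orientation (T : finType) (N : nat) (v : 'I_N -> bool -> T)
    (e : {ffun 'I_N -> bool}) : int :=
  (\prod_i (-1) ^+ (~~ e i)) * inversion_sign (fun i => v i (e i)).

Definition crosspolytope (T : finType) (K : simplicial_complex T) (k N : nat)
    (v : 'I_N -> bool -> T) : kchain K k :=
  [ffun s => \sum_(e | val s == facet v e) orientation v e].

Definition flip (N : nat) (i : 'I_N) (e : {ffun 'I_N -> bool}) :
    {ffun 'I_N -> bool} := [ffun j => e j (+) (j == i)].

Lemma flipK (N : nat) (i : 'I_N) : involutive (flip i).
Proof. by move=> e; apply/ffunP => j; rewrite !ffunE addbK. Qed.

Lemma facetD1 (T : finType) (N : nat) (v : 'I_N -> bool -> T)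
    (e : {ffun 'I_N -> bool}) (i : 'I_N) :
  injective (fun j => v j (e j)) ->
  facet v e :\ v i (e i) = [set v j (e j) | j in [set~ i]].
Proof.
move=> xI; apply/setP => w; rewrite in_setD1.
apply/andP/imsetP => [[wi /imsetP[j _ wj]]|[j]].
  by exists j; rewrite // !inE; apply: contraNneq wi => <-; rewrite wj.
rewrite !inE => ji ->; rewrite imset_f ?inE //.
by rewrite (inj_eq xI).
Qed.

(** The two facets on either side of a ridge induce opposite orientations on
    it: by [inversion_sign_delete], passing from one to the other changes only
    the factor attached to the choice at [i]. *)
Lemma orientation_flip (T : finType) (N : nat) (v : 'I_N -> bool -> T)
    (e : {ffun 'I_N -> bool}) (i : 'I_N) :
  (forall i j b c, v i b = v j c -> i = j) ->
  let induced e := (-1) ^+ #|[set w in facet v e |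
    (enum_rank w < enum_rank (v i (e i)))%N]| * orientation v e in
  induced (flip i e) = - induced e.
Proof.
move=> vI /=.
have xI e' : injective (fun j => v j (e' j)) by move=> a b; apply: vI.
rewrite !(mulrC ((-1) ^+ _)) /orientation -!mulrA.
rewrite !(@inversion_sign_delete _ _ (fun j => v j (_ j))) //.
rewrite !(bigD1 (P := predT) i) //= !ffunE eqxx addbT.
rewrite (eq_bigr (fun j => (-1) ^+ (~~ e j))); last first.
  by move=> j ji; rewrite ffunE (negbTE ji) addbF.
rewrite [X in _ * (_ * X)](eq_bigr (fun a : 'I_N =>
    \prod_(b : 'I_N | (a < b)%N && (b != i))
      inversion (fun j => v j (e j)) a b)).
  by case: (e i) => /=; ring.
move=> a ai; apply: eq_bigr => b /andP[_ bi].
by rewrite /inversion !ffunE (negbTE ai) (negbTE bi) !addbF.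
Qed.

(** The involution [flip i] pairs the facets adjacent to a ridge that misses
    the index [i], and the contributions of a pair cancel. *)
Lemma crosspolytope_cycle (T : finType) (K : simplicial_complex T)
    (k N : nat) (v : 'I_N -> bool -> T) :
  N = k.+1 -> (forall i j b c, v i b = v j c -> i = j) ->
  (forall e, facet v e \in K) -> boundary (crosspolytope K k v) = 0.
Proof.
move=> Nk vI vK; apply/ffunP => t; rewrite !ffunE.
have xI e : injective (fun j => v j (e j)) by move=> a b; apply: vI.
under eq_bigr do rewrite ffunE big_mkcond mulr_sumr.
rewrite exchange_big /=.
have facetP e : (facet v e \in K) && (#|facet v e| == k.+1).
  by rewrite vK card_imset // cardsT card_ord Nk eqxx.
transitivity (\sum_e incidence (facet v e) (val t) * orientation v e).
  apply: eq_bigr => e _; rewrite (bigD1 (to_ksimplex (facetP e))) //= eqxx.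
  rewrite big1 ?addr0 // => s; rewrite -val_eqE /= => /negbTE ->.
  by rewrite mulr0.
transitivity (\sum_e \sum_i if val t == facet v e :\ v i (e i) then
  (-1) ^+ #|[set w in facet v e | (enum_rank w < enum_rank (v i (e i)))%N]|
    * orientation v e else 0).
  apply: eq_bigr => e _; rewrite /incidence big_mkcondr.
  rewrite big_imset /=; last first.
    by move=> a b _ _; apply: xI.
  rewrite mulr_suml; apply: eq_big => [i|i _]; first by rewrite inE.
  by case: ifP => //; rewrite mul0r.
rewrite exchange_big big1 //= => i _.
(* Reindexing by the flip shows that the sum is its own opposite. *)
set S := LHS; suff : S = - S by lia.
rewrite {1}/S (reindex_inj (inv_inj (flipK i))) -sumrN.
apply: eq_bigr => e _ /=.
rewrite orientation_flip // !facetD1 //.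
rewrite (_ : [set v j (flip i e j) | j in [set~ i]] =
             [set v j (e j) | j in [set~ i]]); last first.
  by apply: eq_in_imset => j; rewrite !inE ffunE => /negbTE ->; rewrite addbF.
by case: ifP => //; rewrite oppr0.
Qed.

(** * Detecting the fundamental cycle *)

Lemma homology_neq0 (T : finType) (K : simplicial_complex T) (k : nat)
    (c : kchain K k) : boundary c = 0 ->
  (forall b : kchain K k.+1, boundary b <> c) ->
  exists x : homology K k, x != 0.
Proof.
move=> /eqP cZ cNB; pose z : kcycle K k := KCycle cZ.
exists (\pi_(homology K k) z)%qT.
rewrite -[0](pi_zeror (s := homology K k)) -Quotient.idealrBE subr0.
by apply/negP => /asboolP[b /cNB].
Qed.

Lemma orientation_F2 (T : finType) (N : nat) (v : 'I_N -> bool -> T)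
    (e : {ffun 'I_N -> bool}) : (orientation v e)%:~R = 1 :> 'F_2.
Proof.
rewrite /orientation /inversion_sign rmorphM !rmorph_prod /=.
rewrite big1 => [|i _]; last exact: intr_sign_F2.
rewrite mul1r big1 // => a _.
by rewrite rmorph_prod big1 // => b _; apply: intr_sign_F2.
Qed.

(** The map [p] lets vertices outside the cross-polytope lie over the facet
    [F], so that [F] is only required to be maximal among the images under [p].
    It fixes the cross-polytope, so [F] is its only facet over [F], and the
    invariant of the fundamental cycle is 1. *)
Lemma crosspolytope_homology (T : finType) (K : simplicial_complex T)
    (k N : nat) (v : 'I_N -> bool -> T) (p : T -> T) :
  let F := facet v [ffun=> true] in
  N = k.+1 -> (forall i j b c, v i b = v j c -> i = j /\ b = c) ->
  (forall e, facet v e \in K) ->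
  (forall i b, p (v i b) = v i b) ->
  (forall s : {set T}, s \in K -> F \subset p @: s -> p @: s = F) ->
  exists x : homology K k, x != 0.
Proof.
move=> F Nk vI vK pv Fmax.
have cardF e : #|facet v e| = k.+1.
  by rewrite card_imset ?cardsT ?card_ord // => a b /vI[].
apply: (@homology_neq0 _ _ _ (crosspolytope K k v)) => [|b bE].
  by apply: crosspolytope_cycle => // i j b c /vI[].
have := sum_boundary_over_fiber b (cardF _) Fmax; rewrite bE.
apply/eqP; under eq_bigr do rewrite ffunE big_mkcond rmorph_sum.
rewrite exchange_big (bigD1 [ffun=> true]) //= [X in _ + X]big1 => [|e eN].
  have FP : (F \in K) && (#|F| == k.+1) by rewrite vK cardF eqxx.
  have pF : p @: F = F 
    by rewrite /F /facet -imset_comp; apply: eq_imset => i; apply: pv.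
  rewrite (bigD1 (to_ksimplex FP)) /= ?pF //.
  rewrite addr0 eqxx orientation_F2 big1 ?addr0 ?oner_eq0 // => s /andP[_ sN].
  by case: eqP => // sE; case/eqP: sN; apply: val_inj.
rewrite big1 // => s /eqP sF; case: eqP => //= sE; case/eqP: eN.
apply/ffunP => i; rewrite ffunE.
have : v i (e i) \in F.
  by rewrite /F -sF -pv imset_f // sE imset_f.
by case/imsetP=> j _ /vI[_ ->]; rewrite ffunE.
Qed.

(** * Rows of a normalized Hadamard matrix *)

Definition bipolar (m : nat) (f : 'I_m -> int) : Prop :=
  forall j, f j = 1 \/ f j = -1.

Lemma bipolar_dot (m : nat) (f g : 'I_m -> int) : bipolar f -> bipolar g ->
  \sum_j f j * g j = m%:Z - 2 * #|[set j | f j != g j]|%:Z.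
Proof.
move=> fB gB.
rewrite (eq_bigr (fun j => 1 - 2 * (f j != g j)%:Z)) => [|j _]; last first.
  by case: (fB j) => ->; case: (gB j) => ->.
rewrite sumrB sumr_const card_ord -mulr_sumr; congr (_ - _ * _).
  exact: natz.
rewrite -(big_morph Posz PoszD (erefl _)) -sum1_card [in RHS]big_mkcond.
by congr Posz; apply: eq_bigr => j _; rewrite inE; case: eqP.
Qed.

(** The distinguished column is the last one because a point of a cube with
    only [m - 1] coordinates is completed by a 1 in the last place. *)
Definition normalized (m : nat) (G : 'M[int]_m) : Prop :=
  hadamard G /\ forall i j : 'I_m, j.+1 = m -> G i j = 1.

Lemma hadamard_bipolar (m : nat) (G : 'M[int]_m) (i : 'I_m) :
  hadamard G -> bipolar (G i).
Proof. by case=> GB _ _; apply: GB. Qed.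

(** Multiplying on the left by the diagonal matrix of the last column scales
    each row by its last entry, and this diagonal matrix squares to 1. *)
Lemma hadamard_normalize (m : nat) (H : 'M[int]_m) :
  hadamard H -> exists G : 'M[int]_m, normalized G.
Proof.
case: m H => [|m] H HH; first by exists H; split=> // -[].
pose d := \row_i H i ord_max; pose D := diag_mx d.
have [HB HtH HHt] := HH.
have DD : D *m D = 1%:M.
  rewrite /D mulmx_diag -diag_const_mx; congr diag_mx.
  by apply/rowP => i; rewrite !mxE; case: (HB i ord_max) => ->.
have GE i j : (D *m H) i j = H i ord_max * H i j.
  by rewrite mul_diag_mx !mxE.
exists (D *m H); split; last first.
  move=> i j [jm]; rewrite GE (_ : j = ord_max); last exact: val_inj.
  by case: (HB i ord_max) => ->.
split=> [i j||].
- by rewrite GE; case: (HB i ord_max) => ->; case: (HB i j) => ->; auto.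
- by rewrite trmx_mul tr_diag_mx -mulmxA (mulmxA D) DD mul1mx.
- rewrite trmx_mul tr_diag_mx mulmxA -(mulmxA D) HHt.
  by rewrite mul_mx_scalar -scalemxAl DD scale_scalar_mx mulr1.
Qed.

Lemma hadamard_row_orthogonal (m : nat) (G : 'M[int]_m) (i j : 'I_m) :
  hadamard G -> i != j -> \sum_k G i k * G j k = 0.
Proof.
case=> _ _ /matrixP/(_ i j) + ij; rewrite !mxE (negbTE ij) mulr0n => dot0.
by rewrite -[RHS]dot0; apply: eq_bigr => k _; rewrite mxE.
Qed.

(** Let [c i] be the dot product of [u] with row [i].  Then
    [sum_i c i * (m - c i) = m * sum_i c i - m^2 <= 0] with nonnegative terms,
    so each [c i] is 0 or [m]; they cannot all vanish, and [c i = m] means that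
    [u] agrees with row [i] everywhere. *)
Lemma row_of_nonneg_dot (m : nat) (G : 'M[int]_m) (u : 'I_m -> int) :
  (0 < m)%N -> normalized G -> bipolar u ->
  (forall i, 0 <= \sum_j G i j * u j) -> exists i, u =1 G i.
Proof.
move=> m_gt0 [GH Glast] uB c_ge0.
have [_ GtG _] := GH.
pose U := \col_j u j; pose c i := \sum_j G i j * u j.
have cE i : (G *m U) i 0 = c i.
  by rewrite mxE; apply: eq_bigr => j _; rewrite mxE.
have count i : c i = m%:Z - 2 * #|[set j | G i j != u j]|%:Z.
  exact/bipolar_dot/uB/hadamard_bipolar.
(* The column sums vanish except for the last column, by orthogonality with
   that column of ones. *)
have sum_c : \sum_i c i <= m%:Z.
  have jP : (m.-1 < m)%N by rewrite prednK.
  pose j0 := Ordinal jP; have j0m : j0.+1 = m by rewrite /= prednK.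
  have : (G^T *m (G *m U)) j0 0 = m%:Z * u j0.
    by rewrite mulmxA GtG mul_scalar_mx !mxE natz.
  rewrite mxE (eq_bigr c) => [->|i _].
    by case: (uB j0) => ->; lia.
  by rewrite mxE Glast // mul1r cE.
(* Parseval: a Hadamard matrix multiplies squared norms by m. *)
have sum_c2 : \sum_i c i * c i = m%:Z * m%:Z.
  have : ((G *m U)^T *m (G *m U)) 0 0 = m%:Z * m%:Z.
    rewrite trmx_mul mulmxA -(mulmxA U^T) GtG -mulmxA mul_scalar_mx.
    rewrite -scalemxAr !mxE natz; congr (_ * _).
    rewrite (eq_bigr (fun=> 1)) => [|j _].
      by rewrite sumr_const card_ord natz.
    by rewrite !mxE; case: (uB j) => ->.
  by rewrite mxE => <-; apply: eq_bigr => i _; rewrite mxE cE.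
have c_le i : c i <= m%:Z by rewrite count; lia.
have term_ge0 i : 0 <= c i * (m%:Z - c i).
  by rewrite mulr_ge0 ?subr_ge0 //; apply: c_ge0.
have sum0 : \sum_i c i * (m%:Z - c i) = 0.
  apply/eqP; rewrite eq_le sumr_ge0 ?andbT //.
  under eq_bigr do rewrite mulrBr.
  by rewrite sumrB sum_c2 -mulr_suml subr_le0 ler_wpM2r.
have tight i : c i * (m%:Z - c i) = 0.
  exact: (psumr_eq0P _ sum0).
have [i ci] : exists i, c i = m%:Z.
  have /existsP[i ci] : [exists i, c i != 0].
    apply: contraT; rewrite negb_exists => /forallP c0.
    have : m%:Z * m%:Z = 0 :> int.
      by rewrite -sum_c2 big1 // => i _; move: (c0 i); rewrite negbK => /eqP->.
    by nia.
  exists i; move/eqP: (tight i).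
  by rewrite mulf_eq0 (negbTE ci) /= subr_eq0 eq_sym => /eqP.
exists i => j; have : [set j | G i j != u j] == set0.
  by rewrite -cards_eq0; move: (count i); rewrite ci; lia.
by move=> /eqP/setP/(_ j); rewrite !inE => /negbFE/eqP.
Qed.

(** * The cross-polytope in the cube *)

Lemma leq_card_ord (m n : nat) (A : {set 'I_m}) (B : {set 'I_n}) :
  (forall i, i \in A -> exists2 j, j \in B & j = i :> nat) -> (#|A| <= #|B|)%N.
Proof.
move=> AB; rewrite -(card_imset (mem A) (@Some_inj _)).
apply: (leq_trans _ (leq_imset_card (fun j : 'I_n => insub (j : nat)) B)).
apply/subset_leq_card/subsetP => _ /imsetP[i iA ->].
have [j jB ji] := AB i iA.
by apply/imsetP; exists j; rewrite // ji valK.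
Qed.

Definition to_sign (z : int) : sign :=
  if z == 1 then SeqSub (mem_head 1 [:: -1 : int])
  else SeqSub (mem_last (1 : int) [:: -1]).

Lemma to_signK (z : int) : z = 1 \/ z = -1 -> val (to_sign z) = z.
Proof. by case=> ->. Qed.

Lemma val_sign (s : sign) : val s = 1 \/ val s = -1.
Proof.
by case: s => z /= zP; move: zP; rewrite !inE => /orP[]/eqP->; auto.
Qed.

Definition signed_row (m : nat) (G : 'M[int]_m) (i : 'I_m) (b : bool)
    (k : 'I_m) : int :=
  (-1) ^+ (~~ b) * G i k.

(** The length [n] of the cube may be [m - 1], in which case the last entry of
    the row is dropped, or larger than [m], in which case the row is padded. *)
Definition vertex (n m : nat) (G : 'M[int]_m) (i : 'I_m) (b : bool) : cube n :=
  [ffun a : 'I_n =>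
    to_sign (if insub (a : nat) is Some k then signed_row G i b k else 1)].

Definition truncate (n m : nat) (x : cube n) : cube n :=
  [ffun a : 'I_n => if (a < m)%N then x a else to_sign 1].

(** The value 1 out of range matches the last column of a normalized matrix, so
    that [coords] recovers the row from a vertex even when [n = m - 1]. *)
Definition coords (n m : nat) (x : cube n) (k : 'I_m) : int :=
  if insub (k : nat) is Some a then val (x a) else 1.

Lemma signed_row_bipolar (m : nat) (G : 'M[int]_m) (i : 'I_m) (b : bool) :
  hadamard G -> bipolar (signed_row G i b).
Proof.
move=> /(hadamard_bipolar i) GB k; rewrite /signed_row.
by case: b; case: (GB k) => ->; auto.
Qed.

Lemma coords_bipolar (n m : nat) (x : cube n) : bipolar (@coords n m x).
Proof.
by move=> k; rewrite /coords; case: insub => [a|]; [apply: val_sign | left].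
Qed.

Lemma vertexE (n m : nat) (G : 'M[int]_m) (i : 'I_m) (b : bool)
    (a : 'I_n) (k : 'I_m) :
  hadamard G -> a = k :> nat -> val (vertex n G i b a) = signed_row G i b k.
Proof.
move=> GH ak; rewrite ffunE ak valK to_signK //; exact: signed_row_bipolar.
Qed.

Lemma truncate_vertex (n m : nat) (G : 'M[int]_m) (i : 'I_m) (b : bool) :
  truncate m (vertex n G i b) = vertex n G i b.
Proof.
apply/ffunP => a; rewrite !ffunE; case: ltnP => // ma.
by rewrite insubF // ltnNge ma.
Qed.

Lemma coordsE (n m : nat) (x : cube n) (a : 'I_n) (k : 'I_m) :
  a = k :> nat -> coords x k = val (x a).
Proof. by move=> ak; rewrite /coords -ak valK. Qed.

Lemma coords_out (n m : nat) (x : cube n) (k : 'I_m) :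
  (n <= k)%N -> coords x k = 1.
Proof. by move=> nk; rewrite /coords insubF // ltnNge nk. Qed.

Lemma coords_truncate (n m : nat) (x : cube n) :
  @coords n m (truncate m x) =1 coords x.
Proof.
move=> k; have [kn|nk] := ltnP k n; last by rewrite !coords_out.
by rewrite !(@coordsE _ _ _ (Ordinal kn)) // ffunE /= ltn_ord.
Qed.

Lemma coords_vertex (n m : nat) (G : 'M[int]_m) (i : 'I_m) :
  (m - 1 <= n)%N -> normalized G -> coords (vertex n G i true) =1 G i.
Proof.
move=> mn [GH Glast] k; have [kn|nk] := ltnP k n.
  rewrite (@coordsE _ _ _ (Ordinal kn)) // (@vertexE _ _ _ _ _ _ k) //.
  by rewrite /signed_row mul1r.
rewrite coords_out // Glast //; have := ltn_ord k; lia.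
Qed.

Lemma coords_inj (n m : nat) (x y : cube n) :
  @coords n m x =1 coords y -> truncate m x = truncate m y.
Proof.
move=> xy; apply/ffunP => a; rewrite !ffunE; case: ltnP => // am.
by apply: val_inj; have := xy (Ordinal am); rewrite !(@coordsE _ _ _ a).
Qed.

Lemma coords_hamming (n m : nat) (x y : cube n) :
  (#|[set k : 'I_m | coords x k != coords y k]| <= hamming x y)%N.
Proof.
apply: leq_card_ord => k; rewrite inE => xy.
have [kn|nk] := ltnP k n; last by move: xy; rewrite !coords_out ?eqxx.
exists (Ordinal kn) => //; rewrite inE; apply: contraNneq xy => xy.
by rewrite !(@coordsE _ _ _ (Ordinal kn)) // xy.
Qed.

Lemma signed_row_dot (m : nat) (G : 'M[int]_m) (i j : 'I_m) (b c : bool) :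
  hadamard G -> i != j -> \sum_k signed_row G i b k * signed_row G j c k = 0.
Proof.
move=> GH ij.
rewrite (eq_bigr (fun k => (-1) ^+ (~~ b) * (-1) ^+ (~~ c) * (G i k * G j k))).
  by rewrite -mulr_sumr hadamard_row_orthogonal ?mulr0.
by move=> k _; rewrite /signed_row; ring.
Qed.

(** Orthogonal vectors of signs of length [2 * r] differ in exactly [r] places,
    and the vertices differ at most there. *)
Lemma hamming_vertex (n r : nat) (G : 'M[int]_(2 * r)) (i j : 'I_(2 * r))
    (b c : bool) :
  hadamard G -> i != j -> (hamming (vertex n G i b) (vertex n G j c) <= r)%N.
Proof.
move=> GH ij.
have := signed_row_dot b c GH ij.
rewrite bipolar_dot; try exact: signed_row_bipolar.
move=> dot0.
apply: (leq_trans (n := #|[set k | signed_row G i b k != signed_row G j c k]|)).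
  apply: leq_card_ord => a; rewrite inE => xy.
  have [am|ma] := ltnP a (2 * r); last first.
    by move: xy; rewrite !ffunE insubF ?eqxx // ltnNge ma.
  exists (Ordinal am) => //; rewrite inE; apply: contraNneq xy => xy.
  by apply/eqP/val_inj; rewrite !(@vertexE _ _ _ _ _ a (Ordinal am)).
lia.
Qed.

(** If vertices over distinct rows agree, then the products of the entries of
    the two rows are a constant sign [eps] on all columns but the last, and 1
    on the last.  Their sum [1 + (2 * r - 1) * eps] must vanish, so [r = 1] and
    [eps = -1]; as [n] is then at least 2, the last column is visible in the
    cube and forces [eps = 1]. *)
Lemma vertex_inj (n r : nat) (G : 'M[int]_(2 * r)) (i j : 'I_(2 * r))
    (b c : bool) :
  (0 < r)%N -> (2 * r - 1 <= n)%N -> ~ (r = 1%N /\ n = 1%N) -> normalized G ->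
  vertex n G i b = vertex n G j c -> i = j /\ b = c.
Proof.
move=> r_gt0 n_ge not_edge [GH Glast] vE.
have rowE (k : 'I_(2 * r)) :
    (k < n)%N -> signed_row G i b k = signed_row G j c k.
  by move=> kn; rewrite -!(@vertexE n _ _ _ _ (Ordinal kn)) // vE.
have [ij|ij] := eqVneq i j.
  split=> //; move: rowE; rewrite -ij.
  have kP : (0 < 2 * r)%N by lia.
  move=> /(_ (Ordinal kP)); rewrite /signed_row /=.
  have /(_ (Ordinal kP)) := hadamard_bipolar i GH.
  by case: b c {vE} => [] [] //= [] -> e; have := e ltac:(lia).
have lastP : ((2 * r).-1 < 2 * r)%N by lia.
pose l := Ordinal lastP; have lE : l.+1 = (2 * r)%N by rewrite /=; lia.
pose eps : int := (-1) ^+ (~~ b) * (-1) ^+ (~~ c).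
have prodE (k : 'I_(2 * r)) : (k < n)%N -> G i k * G j k = eps.
  move=> /rowE; rewrite /signed_row /eps.
  case: (hadamard_bipolar i GH k) (hadamard_bipolar j GH k) => -> [] ->;
  by case: (b) (c) => [] [].
have := hadamard_row_orthogonal GH ij.
rewrite (bigD1 l) //= !Glast // (eq_bigr (fun=> eps)) => [|k kl]; last first.
  apply: prodE; move: kl (ltn_ord k); rewrite -val_eqE /=; lia.
rewrite sumr_const cardC1 card_ord -mulr_natr natz => dot0.
have epsB : eps = 1 \/ eps = -1.
  by rewrite /eps; case: (b) (c) => [] [] /=; auto.
have r1 : r = 1%N by case: epsB dot0 => ->; lia.
have ln : (l < n)%N by rewrite /=; lia.
by move: (prodE l ln) dot0; rewrite !Glast // => <-; lia.
Qed.

(** If the truncations of [s] include all the positive vertices, then every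
    point [y] of [s] is within [r] of a point over each row, so its dot product
    with each row is at least [2 * r - 2 * r = 0]. *)
Lemma facet_maximal (n r : nat) (G : 'M[int]_(2 * r)) (s : {set cube n}) :
  (0 < r)%N -> (2 * r - 1 <= n)%N -> normalized G ->
  s \in vietoris_rips n r ->
  let F := facet (vertex n G) [ffun=> true] in
  F \subset truncate (2 * r) @: s -> truncate (2 * r) @: s = F.
Proof.
move=> r_gt0 n_ge Gn; rewrite inE => /andP[_ /forall_inP sr] F Fs.
apply/eqP; rewrite eqEsubset Fs andbT; apply/subsetP => _ /imsetP[y ys ->].
have m_gt0 : (0 < 2 * r)%N by lia.
have [i|i yE] := row_of_nonneg_dot m_gt0 Gn (coords_bipolar y).
  have GH := Gn.1; rewrite bipolar_dot;
    [|exact: hadamard_bipolar|exact: coords_bipolar].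
  have /(subsetP Fs)/imsetP[x xs vx] : vertex n G i true \in F.
    by apply/imsetP; exists i; rewrite ?ffunE.
  have xE : coords x =1 G i.
    by move=> k; rewrite -coords_truncate -vx coords_vertex.
  have : (#|[set k : 'I_(2 * r) | coords x k != coords y k]| <= r)%N.
    apply: leq_trans (coords_hamming _ _ _) _.
    by move/forall_inP: (sr x xs); apply.
  rewrite (_ : [set k | G i k != coords y k] =
               [set k : 'I_(2 * r) | coords x k != coords y k]).
    by lia.
  by apply/setP => k; rewrite !inE xE.
apply/imsetP; exists i => //; rewrite ffunE -truncate_vertex.
by apply: coords_inj => k; rewrite coords_vertex.
Qed.

Theorem theorem7 (r : nat) (r_gt0 : (0 < r)%N)
    (hadamard_exists : exists H : 'M[int]_(2 * r), hadamard H)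
    (n : nat) (n_ge : (2 * r - 1 <= n)%N) (not_edge : ~ (r = 1%N /\ n = 1%N)) :
  exists x : homology (vietoris_rips n r) (2 * r - 1), x != 0.
Proof.
have [H /hadamard_normalize[G Gn]] := hadamard_exists.
apply: (@crosspolytope_homology _ _ _ _ (vertex n G) (truncate (2 * r))).
- by lia.
- by move=> i j b c; apply: vertex_inj.
- move=> e; rewrite inE; apply/andP; split.
    have iP : (0 < 2 * r)%N by lia.
    apply/set0Pn; exists (vertex n G (Ordinal iP) (e (Ordinal iP))).
    exact: imset_f.
  apply/forall_inP => _ /imsetP[i _ ->]; apply/forall_inP => _ /imsetP[j _ ->].
  have [<-|ij] := eqVneq i j; last by apply: hamming_vertex => //; case: Gn.
  rewrite /hamming (_ : [set _ | _] = set0) ?cards0 //.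
  by apply/setP => a; rewrite !inE eqxx.
- by move=> i b; apply: truncate_vertex.
- by move=> s sK; apply: facet_maximal.
Qed.
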